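(* Let $D$ be a finite digraph with $n = |V(D)| \geq 1$ vertices. Then there is a digraph $D'$ containing $D$ as an induced subdigraph (i.e. $V(D) \subseteq V(D')$ and the edge relation of $D'$ restricted to $V(D)$ equals that of $D$) such that $D'$ is simple and $|V(D')| - |V(D)| \leq \lceil \log_4(n+1) \rceil$.
   Context: A digraph is a set $V$ with an arbitrary binary relation $\rightarrow$ on $V$ (no restrictions; so two vertices $u,v$ may satisfy $u\to v$, $v \to u$, both, or neither). An interval of a digraph is a set $I \subseteq V$ such that for all $x,y \in I$ and all $z \in V \setminus I$: $x \to z \iff y \to z$ and $z \to x \iff z \to y$. The empty set, singletons and $V$ are intervals; other intervals are proper. A digraph is simple if it has no proper intervals. *)

(* Defs.v *)
From mathcomp Require Import all_boot.
Set Implicit Arguments.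
Unset Strict Implicit.
Unset Printing Implicit Defensive.

(* A finite digraph is a finType [V] of vertices together with an arbitrary
   relation [e : rel V]; loops are allowed. *)

Definition interval (V : finType) (e : rel V) (I : {set V}) : Prop :=
  forall x y z : V, x \in I -> y \in I -> z \notin I ->
    (e x z <-> e y z) /\ (e z x <-> e z y).

Definition proper_interval (V : finType) (e : rel V) (I : {set V}) : Prop :=
  [/\ interval e I, I <> set0, (forall x : V, I <> [set x]) & I <> [set: V]].

Definition simple_digraph (V : finType) (e : rel V) : Prop :=
  forall I : {set V}, ~ proper_interval e I.

(* The inclusion of the vertex set of an induced subdigraph is rendered as an
   injection [f] along which the edge relation of the larger digraph pulls back
   to that of the smaller one. *)
Definition induced_embedding (V W : finType) (e : rel V) (e' : rel W)
    (f : V -> W) : Prop :=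
  injective f /\ forall x y : V, e' (f x) (f y) = e x y.

(* [up_log p m] is the least [k] such that [m <= p ^ k], that is, the ceiling of
   the base-[p] logarithm of [m], for [1 < p] and [0 < m]. *)
Definition ceil_log4 (m : nat) : nat := up_log 4 m.

(* Main.v *)
Require Import Defs.
From mathcomp Require Import all_boot all_fingroup zify.

Set Implicit Arguments.
Unset Strict Implicit.
Unset Printing Implicit Defensive.

(** Let [k] be the prescribed number of new vertices, and let all pairs of new
    vertices get the same symmetric colour [o] (the colour of an ordered pair
    being its two edge bits).  A vertex of [D] is joined to the new vertices
    according to a code, one colour per new vertex, and distinct vertices get
    distinct codes, so no interval of size at least two avoids the new vertices.
    For [k >= 2] one vertex [z] gets the code [(p, q, ..., q)] with [p], [q], [o]
    distinct.  This kills the remaining intervals as soon as (1) a code equal to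
    [o] outside a coordinate [a] is not given to an [x] with [c(z, x)] equal to
    the [a]-th entry of the code of [z], (2) a constant code [c] is not given to
    an [x] with [c(x, z) = c], and (3) all codes with two entries [p] and the
    others [o] are used.  Each nonzero code is thus forbidden for at most one
    value of [c(z, x)], and an exchange argument yields an assignment without
    conflicts once [p], [q] are rare enough among the [c(z, x)] and these are not
    all equal to some [r <> o]. *)

(** * Colours of ordered pairs of vertices *)

Definition edge_color (V : finType) (e : rel V) (x y : V) : bool * bool :=
  (e x y, e y x).

Definition flip (c : bool * bool) : bool * bool := (c.2, c.1).

Lemma flipK : involutive flip.
Proof. by case. Qed.

Lemma edge_colorC (V : finType) (e : rel V) (x y : V) :
  edge_color e y x = flip (edge_color e x y).
Proof. by []. Qed.

Lemma interval_color (V : finType) (e : rel V) (I : {set V}) (x y z : V) :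
  interval e I -> x \in I -> y \in I -> z \notin I ->
  edge_color e z x = edge_color e z y.
Proof.
move=> intI xI yI zI; have [hxy hyx] := intI x y z xI yI zI.
by congr pair; apply/idP/idP; tauto.
Qed.

Lemma color_notin (s : seq (bool * bool)) :
  size s <= 3 -> exists c, c \notin s.
Proof.
move=> s3; apply/existsP; apply: contraLR s3.
rewrite negb_exists -ltnNge => /forallP all_s.
have <- : #|{: bool * bool}| = 4 by rewrite card_prod card_bool.
apply: leq_trans (card_size s); apply/subset_leq_card/subsetP => c _.
by have := all_s c; rewrite negbK.
Qed.

(** * Adjoining new vertices, and a criterion for simplicity *)

Section Extension.

Variables (V K : finType) (e : rel V) (s : bool) (phi : V -> K -> bool * bool).

Definition extension_rel : rel (V + K) := fun u v =>
  match u, v with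
  | inl x, inl y => e x y
  | inl x, inr a => (phi x a).1
  | inr a, inl x => (phi x a).2
  | inr _, inr _ => s
  end.

Local Notation o := (s, s).

Lemma extension_embedding : induced_embedding e extension_rel inl.
Proof. by split=> // x y [->]. Qed.

Lemma color_lr x a : edge_color extension_rel (inl x) (inr a) = phi x a.
Proof. by rewrite /edge_color /=; case: (phi x a). Qed.

Lemma color_rl a x : edge_color extension_rel (inr a) (inl x) = flip (phi x a).
Proof. by rewrite edge_colorC color_lr. Qed.

Lemma proper_interval_new (I : {set V + K}) :
  (forall x y, phi x =1 phi y -> x = y) ->
  proper_interval extension_rel I ->
  (exists a, inr a \in I) /\
  (forall a, exists2 u, u \in I & u != inr a).
Proof.
move=> phi_inj [intI I0 I1 IT].
have I2 u : exists2 v, v \in I & v != u.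
  apply/exists_inP; apply: contra_notT (I1 u) => /exists_inPn I1u.
  apply/setP => v; rewrite inE; apply/idP/eqP => [/I1u|->].
    by rewrite negbK => /eqP.
  have /set0Pn[w wI] : I != set0 by apply/eqP.
  by have := I1u w wI; rewrite negbK => /eqP <-.
split=> [|a]; last exact: I2.
apply/existsP; apply: contra_notT I0 => /existsPn noK.
apply/setP => u; rewrite inE; apply/negP => uI.
case: u uI => [x xI|a]; last exact/negP.
have [[y yI /eqP[]|a aI _]] := I2 (inl x); last by have := noK a; rewrite aI.
by congr inl; apply: phi_inj => a; apply: (can_inj flipK);
  rewrite -!color_rl (interval_color intI yI xI) ?noK.
Qed.

(** Cases by the new vertices in a proper interval. Several but not all: excluded by the last
    hypothesis. Exactly one, [a]: [z] lies outside by the third, and an old [x] inside contradicts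
    the fourth. All: [z] lies inside by the second, and an old vertex outside contradicts the
    fifth. *)
Lemma extension_simple (z : V) :
  (forall x y, phi x =1 phi y -> x = y) ->
  (exists a b, phi z a <> phi z b) ->
  (forall a, exists2 b, b != a & phi z b <> o) ->
  (forall a x, (forall b, b != a -> phi x b = o) ->
     phi z a <> edge_color e z x) ->
  (forall x, x != z -> ~ (forall a, phi x a = edge_color e x z)) ->
  (forall a a' b, a != a' -> b != a -> b != a' ->
     exists v, phi v a <> phi v a' /\ phi v b <> o) ->
  simple_digraph extension_rel.
Proof.
move=> phi_inj z_nconst z_supp z_single z_const triple I pI.
have [[a aI] I2] := proper_interval_new phi_inj pI.
have [intI _ _ IT] := pI.
(* Seen from a new vertex outside, old vertices of [I] look like [a], whose colour is [o]. *)
have old_zero x b : inl x \in I -> inr b \notin I -> phi x b = o.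
  move=> xI bI; apply: (can_inj flipK).
  by rewrite -color_rl (interval_color intI xI aI bI).
have old_const x b c : inl x \notin I -> inr b \in I -> inr c \in I ->
  phi x b = phi x c.
  by move=> xI bI cI; rewrite -!color_lr (interval_color intI bI cI).
have [/existsP[b bI]|/existsPn allK] := boolP [exists b, inr b \notin I].
  have [[a' a'I /eqP a'a]|noa'] :=
    altP (@exists_inP _ (fun c => inr c \in I) (fun c => c != a)).
    have ab : b != a by apply: contraNneq bI => ->.
    have a'b : b != a' by apply: contraNneq bI => ->.
    have aa' : a != a' by rewrite eq_sym; apply/eqP.
    (* [v] tells [a] from [a'], so it must lie in [I]; its colour toward [b] then has to be [o]. *)
    have [v [va vb]] := triple _ _ _ aa' ab a'b.
    have [vI|vI] := boolP (inl v \in I); first exact/vb/old_zero.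
    exact/va/old_const.
  have Ja c : c != a -> inr c \notin I.
    move=> ca; apply/negP => cI; move/negP: noa'; apply.
    by apply/exists_inP; exists c.
  have [[x xI _|c cI ca]] := I2 a; last first.
    have ca' : c != a by apply: contraNneq ca => ->.
    by have := Ja c ca'; rewrite cI.
  have zI : inl z \notin I.
    apply/negP => zI; have [c ca] := z_supp a; apply.
    exact/old_zero/Ja.
  apply: (z_single a x) => [c ca|]; first exact/old_zero/Ja.
  by rewrite -color_lr (interval_color intI aI xI zI).
have {}allK c : inr c \in I by have := allK c; rewrite negbK.
have [zI|zI] := boolP (inl z \in I); last first.
  by have [b [c]] := z_nconst; apply; apply: old_const.
have [/existsP[v vI]|/existsPn allV] := boolP [exists v, inl v \notin I].
  have vz : v != z by apply: contraNneq vI => ->.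
  apply: (z_const v vz) => c.
  by rewrite -color_lr (interval_color intI (allK c) zI vI).
apply: IT; apply/setP => [[v|c]]; rewrite inE ?allK //.
by have := allV v; rewrite negbK.
Qed.

End Extension.

(** * One new vertex, for at most three old ones *)

Lemma simple_extension_one (V : finType) (e : rel V) :
  0 < #|V| <= 3 ->
  exists phi : V -> unit -> bool * bool,
    simple_digraph (extension_rel e false phi).
Proof.
move=> V3.
(* The three names may coincide. *)
have [x [y [z cover]]] : exists x y z : V, forall v, v \in [:: x; y; z].
  move: V3; rewrite cardE; have := mem_enum V.
  case: (enum V) => [|x [|y [|z []]]] //= enumV _.
  - by exists x, x, x => v; have := enumV v; rewrite !inE => ->.
  - by exists x, y, y => v; have := enumV v; rewrite !inE => /orP[] ->; rewrite ?orbT.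
  - by exists x, y, z => v; rewrite enumV.
pose c := edge_color e.
(* Given the new vertex and an old one in [I], [cy] forces [y] into [I]; then [cz <> c z y] forces
   [z], and [cx <> c x y] forces [x]. The three colours are also kept distinct. *)
have [cy] := @color_notin [:: c y x; c y z] isT.
have [cz] := @color_notin [:: c z x; c z y; cy] isT.
have [cx] := @color_notin [:: c x y; cy; cz] isT.
rewrite !inE !negb_or => /and3P[cxy cxcy cxcz] /and3P[czx czy czcy] /andP[cyx cyz].
pose phi v (_ : unit) := if v == y then cy else if v == z then cz else cx.
exists phi => I pI.
have phi_inj u v : phi u =1 phi v -> u = v.
  move/(_ tt); rewrite /phi; have := cover u; have := cover v; rewrite !inE.
  have [->|uy] := eqVneq u y; have [->|vy] := eqVneq v y => //=.
  - by case: (v == z) => _ _ E; move: cxcy czcy; rewrite E eqxx.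
  - by case: (u == z) => _ _ E; move: cxcy czcy; rewrite E eqxx.
  have [->|uz] := eqVneq u z; have [->|vz] := eqVneq v z => //=.
  - by move=> _ _ E; move: cxcz; rewrite E eqxx.
  - by move=> _ _ E; move: cxcz; rewrite E eqxx.
  by rewrite !orbF => /eqP-> /eqP->.
have [[[] aI] I2] := proper_interval_new phi_inj pI.
have [intI _ _ IT] := pI.
have out v a : inl v \notin I -> inl a \in I -> phi v tt = c v a.
  by move=> vI aI'; rewrite -(color_lr e false phi) (interval_color intI aI aI' vI).
have [[a aI' _|[] //]] := I2 tt.
have [yI|yI] := boolP (inl y \in I); last first.
  have ay : a != y by apply: contraNneq yI => <-.
  have := out _ _ yI aI'; rewrite /phi eqxx => cyE.
  have := cover a; rewrite !inE (negPf ay) /= => /orP[] /eqP aE.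
    by rewrite cyE aE eqxx in cyx.
  by rewrite cyE aE eqxx in cyz.
have [zI|zI] := boolP (inl z \in I); last first.
  have zy : z != y by apply: contraNneq zI => ->.
  by have := out _ _ zI yI; rewrite /phi (negPf zy) eqxx => czE; rewrite czE eqxx in czy.
have [xI|xI] := boolP (inl x \in I).
  apply: IT; apply/setP => [[v|[]]]; rewrite inE ?aI //.
  by have := cover v; rewrite !inE => /or3P[] /eqP ->.
have xy : x != y by apply: contraNneq xI => ->.
have xz : x != z by apply: contraNneq xI => ->.
have := out _ _ xI yI; rewrite /phi (negPf xy) (negPf xz) => cxE.
by rewrite cxE eqxx in cxy.
Qed.

(** * Assignments of codes without conflicts *)

Section Assignment.

Variables (V C R : finType) (D : {set V}) (S Q : {set C}).
Variables (col : V -> R) (forbid : C -> pred R).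

Let placed (phi : {ffun V -> C}) :=
  [&& dinjectiveb phi D, phi @: D \subset S & Q \subset phi @: D].

Let bad (phi : {ffun V -> C}) := [set x in D | forbid (phi x) (col x)].

(** List [Q] before the rest of [S] and match [D] with an initial segment, which covers [Q]; [g0] is
    only a default for [nth]. *)
Lemma placement_exists (g0 : C) :
  Q \subset S -> #|Q| <= #|D| -> #|D| <= #|S| -> exists phi, placed phi.
Proof.
move=> QS QD DS; pose L := enum Q ++ enum (S :\: Q).
have sizeL : size L = #|S|.
  by rewrite size_cat -!cardE -(cardsID Q S) (setIidPr QS).
have uniqL : uniq L.
  rewrite cat_uniq !enum_uniq andbT /=; apply/hasPn => g.
  by rewrite !mem_enum inE => /andP[].
have memL g : (g \in L) = (g \in S).
  rewrite mem_cat !mem_enum inE; have /implyP := subsetP QS g.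
  by case: (g \in Q); case: (g \in S).
have index_lt x : x \in D -> index x (enum D) < size L.
  move=> xD; apply: leq_trans (_ : #|D| <= _); last by rewrite sizeL.
  by rewrite cardE index_mem mem_enum.
exists [ffun x => nth g0 L (index x (enum D))]; apply/and3P; split.
- apply/dinjectiveP => x y xD yD; rewrite !ffunE => /eqP.
  rewrite nth_uniq ?index_lt // => /eqP.
  by apply: (@index_inj _ x (enum D)); rewrite mem_enum.
- apply/subsetP => _ /imsetP[x xD ->]; rewrite ffunE -memL.
  exact/mem_nth/index_lt.
- apply/subsetP => g gQ; have gQ' : g \in enum Q by rewrite mem_enum.
  have iQ : index g (enum Q) < size (enum D).
    by rewrite -cardE (leq_trans _ QD) // cardE index_mem.
  have [v0 _] : exists v0 : V, v0 \in D.
    by apply/set0Pn; rewrite -card_gt0 cardE (leq_trans _ iQ).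
  apply/imsetP; exists (nth v0 (enum D) (index g (enum Q))).
    by rewrite -mem_enum mem_nth.
  rewrite ffunE index_uniq ?enum_uniq // nth_cat index_mem gQ'.
  by rewrite nth_index.
Qed.

(* In a placement with the fewest conflicts, a conflict at [x] can be repaired
   neither by moving [x] to a free code nor by exchanging the codes of [x] and
   some [y]; so every code permitted to [x] is held by another vertex of the
   same colour, against the counting hypothesis. *)
Lemma conflict_free_placement (g0 : C) :
  Q \subset S -> #|Q| <= #|D| -> #|D| <= #|S| ->
  (forall g r, g \in Q -> ~~ forbid g r) ->
  (forall g r r', g \in S -> forbid g r -> forbid g r' -> r = r') ->
  (forall g r, g \in S -> forbid g r ->
    #|[set y in D | col y == r]| + #|[set h in S | forbid h r]| <= #|S|) ->
  exists phi : {ffun V -> C},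
    [/\ {in D &, injective phi}, {in D, forall x, phi x \in S},
        Q \subset phi @: D & {in D, forall x, ~~ forbid (phi x) (col x)}].
Proof.
move=> QS QD DS freeQ forbid_inj room.
have [phi0 phi0P] := placement_exists g0 QS QD DS.
have [phi placed_phi phi_min] := arg_minnP (fun phi => #|bad phi|) phi0P.
have /and3P[/dinjectiveP phi_inj phiS Qphi] := placed_phi.
have inS x : x \in D -> phi x \in S.
  by move=> xD; apply/(subsetP phiS)/imset_f.
exists phi; split=> // x xD; apply/negP => xbad.
have improve psi : placed psi -> ~~ forbid (psi x) (col x) ->
  (forall v, v \in D -> v != x -> forbid (psi v) (col v) ->
     forbid (phi v) (col v)) -> False.
  move=> /phi_min; rewrite leqNgt => /negP leq_bad psix psiv; apply: leq_bad.
  apply/proper_card/properP; split.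
    apply/subsetP => v; rewrite !inE => /andP[vD vbad]; rewrite vD /=.
    by apply: psiv => //; apply: contraTneq vbad => ->.
  by exists x; rewrite inE xD // negb_and psix.
pose r := col x.
have held g : g \in S -> ~~ forbid g r ->
  exists2 y, y \in [set y in D | col y == r] :\ x & g = phi y.
  move=> gS gr; have [/imsetP[y yD gE]|gfree] := boolP (g \in phi @: D).
    exists y => //; rewrite !inE yD /=.
    have yx : y != x by apply: contraNneq gr => yx; rewrite gE yx.
    rewrite yx /=; apply/eqP/eqP; apply: contraT => ry.
    pose psi := [ffun v => phi (tperm x y v)].
    have tD v : v \in D -> tperm x y v \in D by case: tpermP => // ->.
    have imE : psi @: D = phi @: D.
      apply/setP => h; apply/imsetP/imsetP => -[v vD ->].
        by exists (tperm x y v); [exact: tD | rewrite ffunE].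
      by exists (tperm x y v); [exact: tD | rewrite ffunE tpermK].
    case: (improve psi).
    - rewrite /placed imE phiS Qphi !andbT; apply/dinjectiveP => u v uD vD.
      rewrite !ffunE => E; apply: (@perm_inj _ (tperm x y)).
      by apply: phi_inj E; apply: tD.
    - by rewrite ffunE tpermL -gE.
    (* [y] receives the old code of [x], which is forbidden only for the colour of [x]. *)
    - move=> v vD vx; rewrite ffunE; case: tpermP => [->|->|//] // xy.
      by rewrite (forbid_inj _ _ _ (inS _ xD) xy xbad) eqxx in ry.
  pose psi := [ffun v => if v == x then g else phi v].
  have psix : psi x = g by rewrite ffunE eqxx.
  have psiv v : v != x -> psi v = phi v by rewrite ffunE => /negPf->.
  case: (improve psi) => [||v vD vx]; rewrite ?psix ?psiv //.
  apply/and3P; split.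
  - apply/dinjectiveP => u v uD vD.
    have [->|ux] := eqVneq u x; have [->|vx] := eqVneq v x => //.
    + by rewrite psix psiv // => gE; rewrite gE imset_f in gfree.
    + by rewrite psix psiv // => gE; rewrite -gE imset_f in gfree.
    + by rewrite !psiv //; apply: phi_inj.
  - apply/subsetP => _ /imsetP[v vD ->].
    by have [->|vx] := eqVneq v x; rewrite ?psix ?psiv ?inS.
  (* The code given up by [x] is forbidden for some colour, so it is not in [Q]. *)
  - apply/subsetP => h hQ; have /imsetP[v vD hE] := subsetP Qphi h hQ.
    apply/imsetP; exists v; rewrite ?psiv //.
    by apply: contraTneq xbad => <-; rewrite -hE freeQ.
have : #|S :\: [set h | forbid h r]| <= #|[set y in D | col y == r] :\ x|.
  apply: leq_trans (leq_imset_card phi _).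
  apply/subset_leq_card/subsetP => g; rewrite !inE => /andP[gr gS].
  by have [y yP ->] := held g gS gr; apply: imset_f.
have := room _ _ (inS _ xD) xbad; rewrite -/r (setIdE S).
rewrite -(cardsID [set h | forbid h r] S) (cardsD1 x [set y in D | _]).
by rewrite inE xD eqxx; lia.
Qed.

End Assignment.

(** * Choice of the vertex [z] and of the colours [o], [p], [q] *)

Lemma varied_vertex (V : finType) (e : rel V) :
  2 < #|V| ->
  exists z s, forall r, r != (s, s) ->
    exists2 u, u != z & edge_color e z u != r.
Proof.
move=> V3; pose c := edge_color e.
have [/existsP[z /exists_inP[u uz /exists_inP[v vz cuv]]]|/existsPn same] :=
  boolP [exists z, [exists (u | u != z), [exists (v | v != z), c z u != c z v]]].
  exists z, false => r _; have [cur|cur] := eqVneq (c z u) r.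
    by exists v; rewrite // -/c eq_sym -cur.
  by exists u.
(* Now each vertex sees all others in one colour. Going round a triangle shows this colour to be
   symmetric, so it can serve as [(s, s)], the excluded value of [r]. *)
have {}same z u v : u != z -> v != z -> c z u = c z v.
  move=> uz vz; apply/eqP; have /exists_inPn/(_ u uz) := same z.
  by move/exists_inPn/(_ v vz); rewrite negbK.
have [x [y [w [yx wx wy]]]] :
  exists x y w : V, [/\ y != x, w != x & w != y].
  have := enum_uniq V; move: V3; rewrite cardE.
  case: (enum V) => [|x [|y [|w r]]] //= _.
  rewrite !inE !negb_or -!andbA => /and5P[xy xw _ yw _].
  by exists x, y, w; rewrite ![_ == x]eq_sym [w == y]eq_sym.
have flip_cxy : flip (c x y) = c x y.
  rewrite -edge_colorC -/c (same y x w) // ?[x == y]eq_sym //.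
  rewrite /c edge_colorC -/c (same w y x) // ?[_ == w]eq_sym //.
  by rewrite /c edge_colorC flipK -/c; apply: same.
exists x, (c x y).1 => r r_neq; exists y => //; rewrite eq_sym.
suff -> : edge_color e x y = ((c x y).1, (c x y).1) by [].
by move: flip_cxy; rewrite /flip -/c; case: (c x y) => [[] []].
Qed.

(** Of the three colours other than [o], at most one occurs on more than half of [A]; the other two
    are taken. *)
Lemma rare_colors (V : finType) (A : {set V}) (col : V -> bool * bool) o :
  exists p q, [/\ p != q, p != o, q != o,
    2 * #|[set x in A | col x == p]| <= #|A| &
    2 * #|[set x in A | col x == q]| <= #|A|].
Proof.
pose N c := #|[set x in A | col x == c]|.
have N2 c d : c != d -> N c + N d <= #|A|.
  move=> cd; rewrite /N -cardsUI.
  rewrite [_ :&: _](_ : _ = set0) ?cards0 ?addn0; last first.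
    apply/setP => x; rewrite !inE; apply: contra_neqF cd.
    by case/andP => /andP[_ /eqP <-] /andP[_ /eqP <-].
  by apply/subset_leq_card/subsetP => x; rewrite !inE -andb_orr => /andP[].
have [c1] := @color_notin [:: o] isT.
have [c2] := @color_notin [:: o; c1] isT.
have [c3] := @color_notin [:: o; c1; c2] isT.
rewrite !inE !negb_or => /and3P[c3o c31 c32] /andP[c2o c21] c1o.
have := N2 _ _ c31; have := N2 _ _ c32; have := N2 _ _ c21; rewrite /N.
have [N1|N1] := leqP (2 * N c1) #|A|; last first.
  by exists c3, c2; split=> //; move: N1; rewrite /N; lia.
have [N2'|N2'] := leqP (2 * N c2) #|A|; last first.
  by exists c3, c1; split=> //; move: N2'; rewrite /N; lia.
by exists c2, c1.
Qed.

(** * Codes for at least two new vertices *)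

Section ManyNewVertices.

Variables (V : finType) (e : rel V) (m : nat).
Variables (z : V) (s : bool) (p q : bool * bool).

Local Notation o := (s, s).
Local Notation K := 'I_m.+2.
Local Notation code := {ffun K -> bool * bool}.

Hypotheses (pq : p != q) (po : p != o) (qo : q != o).

Definition zero : code := [ffun=> o].
Definition top : code := [ffun a => if a == ord0 then p else q].
Definition two_point (ab : K * K) : code :=
  [ffun c => if c \in [:: ab.1; ab.2] then p else o].
Definition one_point (ac : K * (bool * bool)) : code :=
  [ffun b => if b == ac.1 then ac.2 else o].

(** [top] is kept for [z]; [zero] is excluded because it is [single] at every coordinate. *)
Definition usable : {set code} := ~: [set zero; top].
(* For two new vertices condition (3) is void, and the only code with two
   entries [p] would be constant. *)
Definition reserved : {set code} :=
  if 0 < m then two_point @: [set ab | ab.1 != ab.2] else set0.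

Definition single (g : code) a := [forall b, (b != a) ==> (g b == o)].

(** Here [r] is the colour from [z] to the vertex coded by [g]. The disjuncts are conditions (1) and
    (2); the flip reverses the pair. *)
Definition forbid (g : code) r :=
  [exists a, single g a && (top a == r)] || [forall a, g a == flip r].

Lemma other_coord (a : K) : exists b, b != a.
Proof.
have [->|a0] := eqVneq a ord0; last by exists ord0; rewrite eq_sym.
by exists ord_max.
Qed.

Lemma third_coord (a b : K) : 0 < m -> exists c, c \notin [:: a; b].
Proof.
move=> m0; apply/existsP; apply: contraLR m0; rewrite negb_exists -leqNgt.
move=> /forallP ab; have : #|K| <= size [:: a; b].
  apply: leq_trans (card_size _); apply/subset_leq_card/subsetP => c _.
  by have := ab c; rewrite negbK.
by rewrite card_ord.
Qed.

Lemma singleP (g : code) a : reflect (forall b, b != a -> g b = o) (single g a).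
Proof.
apply: (iffP forallP) => [h b ba|h b]; first by apply/eqP/(implyP (h b)).
by apply/implyP => ba; rewrite h.
Qed.

Lemma top_nz a : top a != o.
Proof. by rewrite ffunE; case: ifP. Qed.

Lemma top_neq_zero : top != zero.
Proof. by apply: contraNneq (top_nz ord0) => ->; rewrite ffunE. Qed.

Lemma card_usable : #|usable| = 4 ^ m.+2 - 2.
Proof.
have := cardsC [set zero; top].
rewrite cards2 eq_sym top_neq_zero card_ffun card_prod card_bool card_ord.
rewrite -/usable -[(2 * 2)%N]/4 => <-; by rewrite addKn.
Qed.

(** As there are two coordinates, a code that is [single] at two places, or both [single] and
    constant, is [zero]. *)
Lemma forbid_inj g r r' : g \in usable -> forbid g r -> forbid g r' -> r = r'.
Proof.
rewrite !inE negb_or => /andP[g0 _].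
have const_single a c : single g a -> ~~ [forall b, g b == flip c].
  move=> /singleP ga; apply: contra g0 => /forallP gc; apply/eqP/ffunP => b.
  have [b' /ga gb'] := other_coord a.
  by rewrite ffunE -gb' (eqP (gc b)) (eqP (gc b')).
case/orP => [/existsP[a /andP[ga /eqP <-]]|gr] /orP[].
- case/existsP => a' /andP[ga' /eqP <-]; congr (top _); apply/eqP.
  apply: contraNT g0 => aa'; apply/eqP/ffunP => b; rewrite ffunE.
  have [ba|/(singleP _ _ ga)//] := eqVneq b a.
  by apply: (singleP _ _ ga'); rewrite ba.
- by move=> gr'; have := const_single _ r' ga; rewrite gr'.
- by case/existsP => a /andP[ga _]; have := const_single _ r ga; rewrite gr.
- move=> /forallP/(_ ord0)/eqP; have /forallP/(_ ord0)/eqP -> := gr.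
  exact: (can_inj flipK).
Qed.

Lemma single_one_point g a : single g a -> g = one_point (a, g a).
Proof.
move=> /singleP ga; apply/ffunP => b; rewrite ffunE /=.
by case: eqVneq => [->|/ga].
Qed.

Lemma forbid_zero g : g \in usable -> ~~ forbid g o.
Proof.
rewrite !inE negb_or => /andP[g0 _]; apply/orP => -[].
  by case/existsP => a /andP[_]; rewrite (negPf (top_nz a)).
move=> /forallP ge; case/eqP: g0; apply/ffunP => a.
by rewrite ffunE (eqP (ge a)).
Qed.

(** The entries of [top] are [p] and [q], so only these can forbid a [single] code; the final 1
    counts the constant code. *)
Lemma card_forbid r :
  #|[set g in usable | forbid g r]| <= (3 * m.+2) * (r \in [:: p; q]) + 1.
Proof.
have -> : 3 * m.+2 = #|setX [set: K] [set~ o]|.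
  by rewrite cardsX cardsT card_ord mulnC cardsC1 card_prod card_bool.
have [rpq|rpq] := boolP (r \in [:: p; q]).
  rewrite muln1 addn1.
  apply: leq_trans (_ : #|[ffun=> flip r] |: one_point @: setX setT [set~ o]| <= _).
    apply/subset_leq_card/subsetP => g; rewrite !inE negb_or.
    case/andP => /andP[g0 _] /orP[/existsP[a /andP[ga _]]|/forallP ge].
      rewrite (single_one_point ga) imset_f ?orbT // !inE /=.
      apply: contra g0 => /eqP gao; rewrite (single_one_point ga) gao.
      by apply/eqP/ffunP => b; rewrite !ffunE /= if_same.
    apply/orP; left; apply/eqP/ffunP => a.
    by rewrite ffunE; apply/eqP/ge.
  rewrite cardsU1; have := leq_imset_card one_point (setX setT [set~ o]).
  by apply: (@leq_add _ _ 1); case: (_ \notin _).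
rewrite muln0 add0n -(cards1 ([ffun=> flip r] : code)).
apply/subset_leq_card/subsetP => g; rewrite !inE negb_or.
case/andP => _ /orP[/existsP[a /andP[_ /eqP tr]]|/forallP ge].
  by move: rpq; rewrite -tr ffunE !inE; case: ifP; rewrite eqxx ?orbT.
by apply/eqP/ffunP => a; rewrite ffunE; apply/eqP/ge.
Qed.

Lemma reserved_usable : reserved \subset usable.
Proof.
rewrite /reserved; case: ifP => [m0|_]; last exact: sub0set.
apply/subsetP => _ /imsetP[[a b] _ ->]; rewrite !inE negb_or.
have [c cab] := third_coord a b m0; apply/andP; split.
  by apply: contraNneq po => /ffunP/(_ a); rewrite !ffunE mem_head => ->.
apply/eqP => /ffunP/(_ c) tc; have := top_nz c.
by rewrite -tc ffunE (negPf cab) eqxx.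
Qed.

(** Two entries [p] prevent [single]; an entry [o] at a third coordinate prevents constancy. *)
Lemma reserved_free g r : g \in reserved -> ~~ forbid g r.
Proof.
rewrite /reserved; case: ifP => [m0|_]; last by rewrite inE.
case/imsetP => -[a b]; rewrite inE /= => ab ->.
have two_p c : c \in [:: a; b] -> two_point (a, b) c = p.
  by rewrite ffunE => ->.
rewrite /forbid negb_or; apply/andP; split.
  apply/existsP => -[c /andP[/singleP sc _]].
  have [ca|ca] := eqVneq a c.
    by case/eqP: po; rewrite -(two_p b) ?sc // ?inE ?eqxx ?orbT // -ca eq_sym.
  by case/eqP: po; rewrite -(two_p a) ?sc // inE eqxx.
have [c cab] := third_coord a b m0.
apply/forallP => tr; case/eqP: po.
rewrite -(two_p a) ?mem_head // (eqP (tr a)) -(eqP (tr c)).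
by rewrite ffunE (negPf cab).
Qed.

Lemma card_reserved : #|reserved| < 4 ^ m.+1.
Proof.
rewrite /reserved; case: ifP => [m0|_]; last by rewrite cards0 expn_gt0.
apply: leq_ltn_trans (leq_imset_card _ _) _.
apply: leq_ltn_trans (max_card _) _; rewrite card_prod card_ord.
(* All ordered pairs are counted; the induction starts at [m = 1] with 9 < 16. *)
case: m m0 => // k _; elim: k => // k IH.
by rewrite expnS; nia.
Qed.

Lemma color_coded_simple_extension :
  4 ^ m.+1 <= #|V| < 4 ^ m.+2 ->
  (forall r, r != o -> exists2 u, u != z & edge_color e z u != r) ->
  (forall r, r \in [:: p; q] ->
     2 * #|[set y in [set~ z] | edge_color e z y == r]| <= #|[set~ z]|) ->
  exists phi : V -> K -> bool * bool, simple_digraph (extension_rel e s phi).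
Proof.
move=> /andP[Vlb Vub] varied rare.
have cardD : #|[set~ z]| = #|V|.-1 by rewrite cardsC1.
(* Tight: one vertex and two codes are set aside, and [#|V|] is at most [4 ^ m.+2 - 1]. *)
have DS : #|[set~ z]| <= #|usable| by rewrite card_usable cardD; lia.
have QD : #|reserved| <= #|[set~ z]|.
  by have := card_reserved; rewrite cardD; lia.
have room g r : g \in usable -> forbid g r ->
  #|[set y in [set~ z] | edge_color e z y == r]|
  + #|[set h in usable | forbid h r]| <= #|usable|.
  move=> gS gr; have ro : r != o.
    by apply: contraTneq gr => ->; apply: forbid_zero.
  have := card_forbid r; have [rpq|_] := boolP (r \in _).
    have := rare r rpq; rewrite card_usable; move: DS; rewrite card_usable.
    (* Half of the usable codes must be at least [3 * m.+2 + 1]; equality holds at [m = 0]. *)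
    have : 6 * m + 16 <= 4 ^ m.+2.
      by elim: (m) => // k; rewrite [4 ^ k.+3]expnS; lia.
    by lia.
  (* Only one code is forbidden here, and [u] frees one place. *)
  have [u uz ur] := varied r ro; rewrite muln0 add0n => H1.
  suff : #|[set y in [set~ z] | edge_color e z y == r]| < #|[set~ z]| by lia.
  apply/proper_card/properP; split.
    by apply/subsetP => y; rewrite inE => /andP[].
  by exists u; rewrite !inE uz // (negPf ur).
have [phi [phi_inj phiS Qphi phi_free]] :=
  conflict_free_placement zero reserved_usable QD DS reserved_free forbid_inj room.
pose psi x := if x == z then top else phi x.
have psiz : psi z = top by rewrite /psi eqxx.
have psiE x : x != z -> psi x = phi x by rewrite /psi => /negPf->.
have inD x : x != z -> x \in [set~ z] by rewrite !inE.
have phi_top x : x != z -> phi x != top.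
  by move=> /inD/phiS; rewrite !inE negb_or => /andP[].
have psi_free x : x != z -> ~~ forbid (psi x) (edge_color e z x).
  by move=> xz; rewrite psiE //; apply/phi_free/inD.
exists psi; apply: (@extension_simple _ _ _ _ _ z).
- move=> x y /ffunP; have [->|xz] := eqVneq x z; have [->|yz] := eqVneq y z => //.
  + by rewrite psiz psiE // => E; have := phi_top _ yz; rewrite -E eqxx.
  + by rewrite psiz psiE // => E; have := phi_top _ xz; rewrite E eqxx.
  + by rewrite !psiE //; apply: phi_inj; apply: inD.
- by exists ord0, ord_max; rewrite psiz !ffunE; apply/eqP.
- move=> a; have [b ba] := other_coord a; exists b => //.
  by rewrite psiz; apply/eqP/top_nz.
- move=> a x sx; rewrite psiz => tx.
  have [xz|xz] := eqVneq x z.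
    have [b ba] := other_coord a; have := sx b ba; rewrite xz psiz.
    exact/eqP/top_nz.
  have /negP := psi_free x xz; apply; apply/orP; left.
  by apply/existsP; exists a; rewrite tx eqxx andbT; apply/singleP.
- move=> x xz cx; have /negP := psi_free x xz; apply; apply/orP; right.
  by apply/forallP => a; rewrite cx -edge_colorC.
- move=> a a' b aa' ba ba'.
  have m0 : 0 < m.
    have : #|[:: a; a'; b]| <= #|K| by apply: max_card.
    rewrite card_ord; have /card_uniqP -> // : uniq [:: a; a'; b].
    by rewrite /= !inE negb_or aa' ![_ == b]eq_sym ba ba'.
  (* This code has [p] at [a] and [b] but [o] at [a']. *)
  have : two_point (a, b) \in reserved.
    by rewrite /reserved m0; apply: imset_f; rewrite inE eq_sym.
  case/(subsetP Qphi)/imsetP => v; rewrite !inE => vz vE.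
  exists v; rewrite psiE // -vE !ffunE !inE !eqxx orbT.
  by rewrite ![a' == _]eq_sym (negPf aa') (negPf ba'); split; apply/eqP.
Qed.

End ManyNewVertices.

(** * The number of new vertices *)

Lemma simple_extension_many (V : finType) (e : rel V) m :
  4 ^ m.+1 <= #|V| < 4 ^ m.+2 ->
  exists s (phi : V -> 'I_m.+2 -> bool * bool),
    simple_digraph (extension_rel e s phi).
Proof.
move=> Vm; have V3 : 2 < #|V|.
  have : 0 < 4 ^ m by rewrite expn_gt0.
  by case/andP: Vm; rewrite expnS; lia.
have [z [s varied]] := varied_vertex e V3.
have [p [q [pq po qo Np Nq]]] :=
  rare_colors [set~ z] (edge_color e z) (s, s).
exists s; apply: (color_coded_simple_extension pq po qo Vm varied) => r.
by rewrite !inE => /orP[] /eqP->.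
Qed.

Theorem theorem6p1 (V : finType) (e : rel V) (n : nat) :
  n = #|V| -> 1 <= n ->
  exists (W : finType) (e' : rel W) (f : V -> W),
    [/\ induced_embedding e e' f,
        simple_digraph e' &
        #|W| - #|V| <= ceil_log4 (n + 1)].
Proof.
move=> nV n0; rewrite /ceil_log4.
suff [K [s [phi [simple_phi <-]]]] : exists (K : finType) s
    (phi : V -> K -> bool * bool),
    simple_digraph (extension_rel e s phi) /\ #|K| = up_log 4 (n + 1).
  exists (V + K)%type, (extension_rel e s phi), inl; split=> //.
    exact: extension_embedding.
  by rewrite card_sum addKn.
have [n3|n3] := leqP n 3.
  have [|phi simple_phi] := @simple_extension_one V e; first by rewrite -nV n0.
  exists unit, false, phi; split=> //; rewrite card_unit.
  by rewrite (@up_log_eq 4 0) //; lia.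
(* The strict lower bound on [n + 1] becomes [4 ^ m.+1 <= n], and the upper bound becomes
   [n < 4 ^ m.+2]. *)
have /andP[] := @up_log_bounds 4 (n + 1) isT (ltac:(lia)).
case: (up_log 4 (n + 1)) => [|[|m]]; try by lia.
rewrite /= => lb ub.
have [|s [phi simple_phi]] := @simple_extension_many V e m; first by lia.
by exists 'I_m.+2, s, phi; rewrite card_ord.
Qed.
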